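(* For every integer $c>2$ there exists a real number $d^*$ with $0<d^*\le 1$ such that for every integer $n\ge 1$ $$\lfloor d^*n\rfloor!\le M(n,\overline{c\mathbb{N}}),$$ where $\overline{c\mathbb{N}}$ denotes the set of natural numbers not divisible by $c$.
   Context: $K_n$ is the complete graph on the vertex set $\{1,\dots,n\}$. Hamiltonian paths of $K_n$ are undirected and are regarded as (labelled) subgraphs of $K_n$. For a set $\mathbb{D}\subseteq\mathbb{N}$, two Hamiltonian paths in $K_n$ are called $\mathbb{D}$-cycle different if the union of the two paths (the graph whose edge set is the union of their edge sets) contains a cycle, not necessarily induced, whose length belongs to $\mathbb{D}$. $M(n,\mathbb{D})$ denotes the largest cardinality of a set of Hamiltonian paths in $K_n$ any two distinct members of which are $\mathbb{D}$-cycle different. *)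

(* Defs.v *)
From mathcomp Require Import all_boot.

Set Implicit Arguments.
Unset Strict Implicit.
Unset Printing Implicit Defensive.

Section HamiltonianPaths.

Variable n : nat.

(* The vertex set {1, ..., n} of K_n is modelled by 'I_n. A spanning subgraph
   is identified with its edge set, a set of unordered pairs [set x; y], so
   that a vertex ordering and its reversal give the same Hamiltonian path. *)
Definition graph := {set {set 'I_n}}.

Definition adj (E : graph) : rel 'I_n := fun x y => [set x; y] \in E.

(* Edges {s_0,s_1}, {s_1,s_2}, ...; zip drops the unmatched last vertex. *)
Definition path_edges (s : seq 'I_n) : graph :=
  [set:: [seq [set e.1; e.2] | e <- zip s (behead s)]].

Definition ham_paths : {set graph} :=
  [set path_edges s | s : n.-tuple 'I_n & uniq s].

Definition is_cycle (E : graph) (s : seq 'I_n) : bool :=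
  [&& 2 < size s, uniq s & cycle (adj E) s].

(* A cycle has distinct vertices, hence length at most n, so the bound on k
   loses nothing; see has_cycleP. *)
Definition has_cycle (D : pred nat) (E : graph) : bool :=
  [exists k : 'I_n.+1, exists s : k.-tuple 'I_n, D k && is_cycle E s].

Lemma has_cycleP (D : pred nat) (E : graph) :
  reflect (exists2 s : seq 'I_n, is_cycle E s & D (size s)) (has_cycle D E).
Proof.
apply: (iffP existsP) => [[k /existsP[s /andP[Dk cs]]] | [s cs Ds]].
  by exists s => //; rewrite size_tuple.
have /and3P[_ us _] := cs.
have ltsn : size s < n.+1.
  by rewrite ltnS -[leqRHS](card_ord n) -(card_uniqP us) max_card.
exists (Ordinal ltsn); apply/existsP; exists (in_tuple s).
exact/andP.
Qed.

Definition cycle_different (D : pred nat) (E1 E2 : graph) : bool :=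
  has_cycle D (E1 :|: E2).

Definition cycle_different_family (D : pred nat) (F : {set graph}) : bool :=
  (F \subset ham_paths) &&
  [forall E1 in F, forall E2 in F, (E1 != E2) ==> cycle_different D E1 E2].

End HamiltonianPaths.

Definition M (n : nat) (D : pred nat) : nat :=
  \max_(F : {set graph n} | cycle_different_family D F) #|F|.

Definition non_multiples (c : nat) : pred nat := fun k => ~~ (c %| k).

(* Main.v *)
Require Import Defs.
From mathcomp Require Import all_boot all_order all_algebra.
From mathcomp Require Import reals.
From mathcomp Require Import zify.


(** Fix a Hamiltonian path [H] with vertices [s_0, ..., s_(n-1)] in this order
    and let [H'] be a Hamiltonian path such that every cycle of the union of [H]
    and [H'] has length divisible by [c].  Then [H'] lies in a set of at most
    [8 ^ n] graphs.  Indeed, call an edge [s_i s_j] of [H'] with [i + 1 < j] a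
    long chord.  It closes a cycle of length [j - i + 1] with the segment of [H]
    from [s_i] to [s_j], so [c] divides [j - i + 1].  If a long chord [s_k s_l]
    is nested inside another one [s_i s_j], that is [i <= k < l <= j], then the
    two chords and the segments of [H] from [s_i] to [s_k] and from [s_l] to
    [s_j] form a cycle, of length
      [(k - i + 1) + (j - l + 1) = (j - i + 1) - (l - k + 1) + 2].
    This is [2] modulo [c], and [c > 2]: contradiction.  So no two long chords
    are nested ([long_chord_nest_free]).  But then the order of the left ends
    agrees with the order of the right ends, and the long chords are recovered
    from the set of their left ends and the set of their right ends
    ([nest_free_eq]).  Together with the set of the [i] such that [s_i s_(i+1)]
    is an edge of [H'], these are three subsets of an [n]-element set
    ([card_bad_paths]).

    A maximal set of pairwise cycle different Hamiltonian paths is therefore of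
    size at least the number of Hamiltonian paths divided by [8 ^ n + 1]
    ([exists_large_clique]).  As there are at least [n! / n] Hamiltonian paths,
    [n! <= M * 16 ^ n] ([fact_le_M]), and an exponential factor is less than the
    quotient of [n!] by [m!] for [m <= n / 512] ([fact_mul_exp16_le]). *)

Set Implicit Arguments.
Unset Strict Implicit.
Unset Printing Implicit Defensive.

(** * A greedy bound *)

(** By maximality, the elements of a maximal clique of [e] and their
    non-neighbours cover [X]. *)
Lemma exists_large_clique (T : finType) (e : rel T) (X : {set T}) (b : nat) :
    symmetric e ->
    (forall x, x \in X -> #|[set y in X | ~~ e x y]| <= b) ->
  exists F : {set T},
    [/\ F \subset X,
        [forall x in F, forall y in F, (x != y) ==> e x y]
      & #|X| <= #|F| * b.+1].
Proof.
move=> sym_e bound.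
pose clique (F : {set T}) := (F \subset X) &&
  [forall x in F, forall y in F, (x != y) ==> e x y].
have clique0 : clique set0.
  by rewrite /clique sub0set; apply/forall_inP => x; rewrite inE.
have [F /maxsetP[/andP[FX Fe] maxF] _] := maxset_exists clique0.
exists F; split=> //.
have cover : X \subset F :|: cover [set [set y in X | ~~ e x y] | x in F].
  apply/subsetP => y yX; rewrite inE; apply/norP => -[yF].
  rewrite cover_imset => /bigcupP ncov.
  have ye x : x \in F -> e x y.
    by move=> xF; apply/negP => /negP nxy; apply: ncov; exists x; rewrite ?inE ?yX.
  suff /maxF : clique (y |: F).
    by move=> /(_ (subsetUr _ _)) eqF; rewrite -eqF setU11 in yF.
  rewrite /clique subUset sub1set yX FX /=.
  have pairs x z : x \in F -> z \in F -> x != z -> e x z.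
    by move=> xF zF; move/forall_inP/(_ x xF)/forall_inP/(_ z zF)/implyP: Fe; apply.
  apply/forall_inP => x; rewrite !inE => /predU1P[-> | xF];
    apply/forall_inP => z; rewrite !inE => /predU1P[-> | zF]; apply/implyP.
  - by rewrite eqxx.
  - by move=> _; rewrite sym_e ye.
  - by move=> _; rewrite ye.
  - exact: pairs.
apply: leq_trans (subset_leq_card cover) _.
apply: leq_trans (leq_card_setU _ _) _; rewrite mulnS leq_add2l.
apply: leq_trans (leq_card_cover _) _.
apply: leq_trans (_ : \sum_(A in [set [set y in X | ~~ e x y] | x in F]) b <= _).
  by apply: leq_sum => _ /imsetP[x xF ->]; apply/bound/(subsetP FX).
by rewrite sum_nat_const leq_mul2r leq_imset_card orbT.
Qed.

(** * Relations without nested pairs *)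

Section NestFree.
Variable n : nat.
Implicit Types C : rel 'I_n.

(** Read [C i j] as: the interval from [i] to [j] belongs to a family.  The
    condition says that the family is an antichain for inclusion; intervals
    sharing an end count as nested, so that [C] is also a partial injection. *)
Definition nest_free C := forall i j k l : 'I_n,
  C i j -> C k l -> i <= k -> l <= j -> i = k /\ j = l.

Definition left_ends C : {set 'I_n} := [set i | [exists j, C i j]].
Definition right_ends C : {set 'I_n} := [set j | [exists i, C i j]].

(** Let [C' i z] and [C' k j], which exist because the end sets agree.  If
    [k < i], then [C k j] by hypothesis, nested with [C i j].  If [i < k], then
    [z < j] since [C'] is nest free; the partner of [z] in [C] lies before [i],
    as [C] is nest free, hence it is a second partner of [z] in [C']. *)
Lemma nest_free_step C C' (i j : 'I_n) :
    nest_free C -> nest_free C' ->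
    left_ends C = left_ends C' -> right_ends C = right_ends C' ->
    (forall k l : 'I_n, k < i -> C k l = C' k l) -> C i j -> C' i j.
Proof.
move=> nfC nfC' eqL eqR IH Cij.
have /existsP[z C'iz] : [exists z, C' i z].
  have : i \in left_ends C' by rewrite -eqL inE; apply/existsP; exists j.
  by rewrite inE.
have /existsP[k C'kj] : [exists k, C' k j].
  have : j \in right_ends C' by rewrite -eqR inE; apply/existsP; exists i.
  by rewrite inE.
have [ki | ik | /val_inj eq_ki] := ltngtP k i; last by rewrite -eq_ki.
  have Ckj : C k j by rewrite IH.
  by have [eq_ki _] := nfC _ _ _ _ Ckj Cij (ltnW ki) (leqnn _); rewrite eq_ki ltnn in ki.
have [jz | zj] := leqP j z.
  by have [eq_ki _] := nfC' _ _ _ _ C'iz C'kj (ltnW ik) jz; rewrite eq_ki ltnn in ik.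
have /existsP[m Cmz] : [exists m, C m z].
  have : z \in right_ends C by rewrite eqR inE; apply/existsP; exists i.
  by rewrite inE.
have [mi | im] := ltnP m i.
  have C'mz : C' m z by rewrite -IH.
  by have [eq_mi _] := nfC' _ _ _ _ C'mz C'iz (ltnW mi) (leqnn _); rewrite eq_mi ltnn in mi.
by have [_ eq_jz] := nfC _ _ _ _ Cij Cmz im (ltnW zj); rewrite eq_jz ltnn in zj.
Qed.

(** In a nest free relation the [r]-th left end is paired with the [r]-th right
    end, so the two sets of ends determine the relation. *)
Lemma nest_free_eq C C' :
    nest_free C -> nest_free C' ->
    left_ends C = left_ends C' -> right_ends C = right_ends C' ->
  C =2 C'.
Proof.
move=> nfC nfC' eqL eqR i j.
have [m] := ubnP (i : nat); elim: m i j => // m IHm i j le_im.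
have IH (k l : 'I_n) : k < i -> C k l = C' k l by move=> lt_ki; apply: IHm; lia.
apply/idP/idP; first exact: nest_free_step.
by apply: nest_free_step => // k l /IH.
Qed.

End NestFree.

(** * Edges and cycles along a path *)

Section PathEdges.
Variable n : nat.
Implicit Types (s t : seq 'I_n) (x y : 'I_n) (E : graph n).

Lemma adj_sym E : symmetric (adj E).
Proof. by move=> x y; rewrite /adj setUC. Qed.

Lemma path_edges_cons x y s :
  path_edges [:: x, y & s] = [set x; y] |: path_edges (y :: s).
Proof. by rewrite /path_edges /= set_cons. Qed.

Lemma path_edges1 x : path_edges [:: x] = set0.
Proof. by apply/setP=> e; rewrite !inE. Qed.

Lemma path_edge_endpoint s (e : {set 'I_n}) x :
  e \in path_edges s -> x \in e -> x \in s.
Proof.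
elim: s => [|y [|z s] IHs]; first by rewrite !inE.
  by rewrite path_edges1 inE.
rewrite path_edges_cons => /setU1P[-> | es xe].
  by rewrite !inE => /orP[] ->; rewrite ?orbT.
by rewrite inE IHs ?orbT.
Qed.

Lemma path_edge_pair s (e : {set 'I_n}) :
  uniq s -> e \in path_edges s -> exists x y, x != y /\ e = [set x; y].
Proof.
elim: s => [|y [|z s] IHs]; first by rewrite inE.
  by rewrite path_edges1 inE.
rewrite path_edges_cons => /andP[ys us] /setU1P[-> | es]; last exact: IHs.
by exists y, z; split=> //; apply: contraNneq ys => ->; rewrite inE eqxx.
Qed.

(** The edge set does not see the direction of the path; the first vertex fixes
    it, since that vertex is an end of exactly one edge. *)
Lemma path_edges_inj x s t :
  uniq (x :: s) -> uniq (x :: t) -> path_edges (x :: s) = path_edges (x :: t) ->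
  s = t.
Proof.
elim: s x t => [|y s IHs] x [|z t] //.
- by move=> _ _ /setP/(_ [set x; z]); rewrite path_edges1 path_edges_cons setU11 inE.
- by move=> _ _ /setP/(_ [set x; y]); rewrite path_edges1 path_edges_cons setU11 inE.
move=> /andP[xs us] /andP[xt ut]; rewrite !path_edges_cons.
have fresh w r : x \notin w :: r -> [set x; w] \notin path_edges (w :: r).
  by apply: contra => /path_edge_endpoint -> //; rewrite set21.
move=> eqE.
have eq_yz : y = z.
  have : [set x; y] \in [set x; z] |: path_edges (z :: t) by rewrite -eqE setU11.
  case/setU1P => [/setP/(_ y) | /path_edge_endpoint/(_ (set21 x y))].
    rewrite set22 => /esym/set2P[] // eq_yx.
    by rewrite eq_yx inE eqxx in xs.
  by rewrite (negPf xt).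
rewrite -{z}eq_yz in xt ut eqE *.
congr (_ :: _); apply: IHs (us) (ut) _.
by rewrite -(setU1K (fresh _ _ xs)) eqE setU1K ?fresh.
Qed.

Lemma adj_path_edges x0 s i :
  i.+1 < size s -> adj (path_edges s) (nth x0 s i) (nth x0 s i.+1).
Proof.
move=> lt_i; rewrite /adj inE; apply/mapP; exists (nth x0 s i, nth x0 s i.+1) => //.
have lt_zip : i < size (zip s (behead s)) by rewrite size_zip size_behead; lia.
by have := mem_nth (x0, x0) lt_zip; rewrite nth_zip_cond lt_zip nth_behead.
Qed.

Lemma path_arc x0 s E i m :
  path_edges s \subset E -> i + m < size s ->
  path (adj E) (nth x0 s i) [seq nth x0 s k | k <- iota i.+1 m].
Proof.
move=> sE; elim: m i => //= m IHm i lt_im.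
rewrite IHm ?andbT; last by lia.
by apply: (subsetP sE); apply: adj_path_edges; lia.
Qed.

Lemma last_iota i m : last i (iota i.+1 m) = i + m.
Proof. by elim: m i => [|m IHm] i /=; rewrite ?addn0 // IHm; lia. Qed.

(** The case [k = i] and [l = i.+1], in which the first chord is an edge of the
    path, is the cycle closed by the single chord between positions [i] and
    [j]; hence both kinds of cycles of the main argument are instances. *)
Lemma two_chord_cycle x0 s E i k l j :
    uniq s -> path_edges s \subset E ->
    i <= k -> k < l -> l <= j -> j < size s ->
    adj E (nth x0 s k) (nth x0 s l) -> adj E (nth x0 s j) (nth x0 s i) ->
    2 < (k - i).+1 + (j - l).+1 ->
  is_cycle E [seq nth x0 s m | m <- iota i (k - i).+1 ++ iota l (j - l).+1].
Proof.
move=> us sE ik kl lj js Ekl Eji size_gt2; apply/and3P; split.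
- by rewrite size_map size_cat !size_iota.
- rewrite map_inj_in_uniq; last first.
    move=> a b; rewrite !mem_cat !mem_iota => Ia Ib /eqP.
    have [lt_a lt_b] : a < size s /\ b < size s by lia.
    by rewrite nth_uniq // => /eqP.
  rewrite cat_uniq !iota_uniq andbT andTb; apply/hasP => -[a].
  by rewrite inE !mem_iota; lia.
- rewrite /= rcons_path map_cat cat_path last_cat /= !last_map !last_iota.
  rewrite !subnKC ?Ekl ?path_arc //; lia.
Qed.

End PathEdges.

(** * Paths that are not cycle different from a given one *)

Section BadPaths.
Variables (n c : nat).
Implicit Types (s t : n.-tuple 'I_n) (E : graph n).

(** Vertices are renamed by their position along [s], so that relations on
    ['I_n] below are relations between positions. *)
Definition long_chord s E : rel 'I_n :=
  fun i j => (i.+1 < j) && adj E (tnth s i) (tnth s j).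

Definition short_edges s E : {set 'I_n} :=
  [set i : 'I_n |
    [exists j : 'I_n, (j == i.+1 :> nat) && adj E (tnth s i) (tnth s j)]].

Definition chord_code s E :=
  (left_ends (long_chord s E), right_ends (long_chord s E), short_edges s E).

(** Both chords have length [-1] modulo [c], so the cycle through two nested
    ones would have length [2] modulo [c]. *)
Lemma long_chord_nest_free s E :
    2 < c -> uniq s ->
    ~~ cycle_different (non_multiples c) (path_edges s) E ->
  nest_free (long_chord s E).
Proof.
move=> c_gt2 us ndiff i j k l /andP[ij Eij] /andP[kl Ekl] ik lj.
have dvd_cycle r : is_cycle (path_edges s :|: E) r -> c %| size r.
  move=> cyc_r; apply: contraNT ndiff => ndvd.
  by apply/has_cycleP; exists r.
pose v := nth (tnth s i) s; pose U := path_edges s :|: E.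
have size_s : size s = n := size_tuple s.
have dvd_chords (i' k' l' j' : nat) :
    i' <= k' -> k' < l' -> l' <= j' -> j' < n ->
    adj U (v k') (v l') -> adj U (v j') (v i') ->
    2 < (k' - i').+1 + (j' - l').+1 -> c %| (k' - i').+1 + (j' - l').+1.
  move=> ik' kl' lj' jn Ukl Uji gt2.
  have js : j' < size s by rewrite size_s.
  have := dvd_cycle _
    (two_chord_cycle us (subsetUl _ E) ik' kl' lj' js Ukl Uji gt2).
  by rewrite size_map size_cat !size_iota.
have adjU (a b : 'I_n) : adj E (tnth s a) (tnth s b) -> adj U (v a) (v b).
  by rewrite /adj /v -!tnth_nth => Eab; rewrite inE Eab orbT.
have dvd_chord (a b : 'I_n) : a.+1 < b -> adj E (tnth s a) (tnth s b) ->
    c %| (b - a).+1.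
  move=> ab Eab.
  have -> : (b - a).+1 = (a - a).+1 + (b - a.+1).+1 by lia.
  apply: dvd_chords => //; try lia; last by apply: adjU; rewrite adj_sym.
  apply: (subsetP (subsetUl _ _)); apply: adj_path_edges.
  by rewrite size_s; apply: ltn_trans (ltn_ord b).
have [/andP[/eqP -> /eqP ->] // | neq] := boolP ((i == k) && (l == j)).
have {}neq : (i != k :> nat) || (l != j :> nat) by rewrite -negb_and.
have dvd_out := dvd_chord _ _ ij Eij.
have dvd_in := dvd_chord _ _ kl Ekl.
have dvd_both : c %| (k - i).+1 + (j - l).+1.
  apply: dvd_chords => //; try lia; first exact: adjU.
  by apply: adjU; rewrite adj_sym.
(* [c] divides both [j - i + 1] and its sum with [2], hence [2]. *)
have : c %| (j - i).+1 + 2.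
  have -> : (j - i).+1 + 2 = (k - i).+1 + (j - l).+1 + (l - k).+1 by lia.
  exact: dvdn_add.
by rewrite dvdn_addr // => /dvdn_leq; lia.
Qed.

(** Applied in both directions, this makes [chord_code s] injective on the paths
    with nest free long chords. *)
Lemma chord_code_subset s t t' :
    uniq s -> uniq t ->
    nest_free (long_chord s (path_edges t)) ->
    nest_free (long_chord s (path_edges t')) ->
    chord_code s (path_edges t) = chord_code s (path_edges t') ->
  path_edges t \subset path_edges t'.
Proof.
move=> us ut nft nft' [eqL eqR eqS].
have eq_long := nest_free_eq nft nft' eqL eqR.
have onto x : exists i, x = tnth s i.
  exact/codomP/(injF_onto (tuple_uniqP s us)).
have sub_adj (i j : 'I_n) : i < j -> adj (path_edges t) (tnth s i) (tnth s j) ->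
    adj (path_edges t') (tnth s i) (tnth s j).
  rewrite leq_eqVlt => /predU1P[ij tij | ij tij].
    have : i \in short_edges s (path_edges t').
      by rewrite -eqS inE; apply/existsP; exists j; rewrite -ij eqxx.
    rewrite inE => /existsP[k /andP[/eqP ki]].
    by have -> : k = j by apply: val_inj; rewrite /= ki.
  have : long_chord s (path_edges t) i j by rewrite /long_chord ij.
  by rewrite eq_long => /andP[].
apply/subsetP => e et; have [x [y [neq_xy def_e]]] := path_edge_pair ut et.
have [i def_x] := onto x; have [j def_y] := onto y.
move: et neq_xy; rewrite {}def_e {}def_x {}def_y => et neq_ij.
have [ij | ji | /val_inj eq_ij] := ltngtP i j.
- exact: sub_adj.
- by rewrite setUC; apply: sub_adj => //; rewrite adj_sym.
- by rewrite eq_ij eqxx in neq_ij.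
Qed.

Lemma card_bad_paths s :
    2 < c -> uniq s ->
  #|[set E in ham_paths n |
      ~~ cycle_different (non_multiples c) (path_edges s) E]| <= 8 ^ n.
Proof.
move=> c_gt2 us; set B := [set E in _ | _].
have inj_code : {in B &, injective (chord_code s)}.
  move=> E E'; rewrite !inE => /andP[/imsetP[t ut ->] nd] /andP[/imsetP[t' ut' ->] nd'].
  move=> eq_code; rewrite !inE in ut ut'.
  have nft := long_chord_nest_free c_gt2 us nd.
  have nft' := long_chord_nest_free c_gt2 us nd'.
  by apply/eqP; rewrite eqEsubset !(chord_code_subset us).
rewrite -(card_in_imset inj_code); apply: leq_trans (max_card _) _.
by rewrite !card_prod -cardsT -powersetT card_powerset cardsT card_ord -!expnMn.
Qed.

End BadPaths.

(** * Counting *)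

(** A vertex ordering is determined by its first vertex and its edge set. *)
Lemma fact_le_card_ham_paths n : 0 < n -> n`! <= n * #|ham_paths n|.
Proof.
case: n => // n _.
pose X := [set t : n.+1.-tuple 'I_n.+1 | all predT t & uniq t].
have -> : n.+1`! = #|X| by rewrite card_uniq_tuples card_ord ffactnn.
pose f (t : n.+1.-tuple 'I_n.+1) := (thead t, path_edges t).
have inj_f : {in X &, injective f}.
  move=> t t'; rewrite !inE => /andP[_ ut] /andP[_ ut'] [].
  case/tupleP: t ut => x s us; case/tupleP: t' ut' => x' s' us'.
  rewrite !theadE => eq_x; rewrite -{x'}eq_x in us' *.
  by move/(path_edges_inj us us')/val_inj => ->.
have -> : n.+1 * #|ham_paths n.+1| = #|setX [set: 'I_n.+1] (ham_paths n.+1)|.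
  by rewrite cardsX cardsT card_ord.
rewrite -(card_in_imset inj_f).
apply/subset_leq_card/subsetP => _ /imsetP[t + ->]; rewrite !inE => /andP[_ ut].
by apply: imset_f; rewrite inE.
Qed.

Lemma fact_le_M n c : 0 < n -> 2 < c -> n`! <= M n (non_multiples c) * 16 ^ n.
Proof.
move=> n_gt0 c_gt2.
have sym_diff : symmetric (@cycle_different n (non_multiples c)).
  by move=> E E'; rewrite /cycle_different setUC.
have [|F [Fham Fdiff cardF]] :=
    @exists_large_clique _ _ (ham_paths n) (8 ^ n) sym_diff.
  by move=> _ /imsetP[s us ->]; rewrite inE in us; apply: card_bad_paths.
have FM : #|F| <= M n (non_multiples c).
  by apply: (leq_bigmax_cond (F := fun F : {set graph n} => #|F|)); apply/andP.
apply: leq_trans (fact_le_card_ham_paths n_gt0) _.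
apply: leq_trans (leq_mul (leqnn n) cardF) _.
rewrite mulnCA leq_mul // (expnMn 2 8).
have : n * 2 <= 2 ^ n by rewrite -(prednK n_gt0) expnSr leq_mul2r ltn_expl.
have : 0 < 8 ^ n by rewrite expn_gt0.
nia.
Qed.

(** The [uphalf n] largest factors of [n!] exceed [n / 2], hence are at least
    [256 = 16 ^ 2], while the others form [n./2`!]. *)
Lemma fact_mul_exp16_le m n : 512 <= n -> m <= n./2 -> m`! * 16 ^ n <= n`!.
Proof.
move=> n_ge m_le.
have le_half : uphalf n <= n by lia.
rewrite -(ffact_fact le_half) mulnC leq_mul //; last first.
  by apply: leq_fact; lia.
apply: (@leq_trans (256 ^ uphalf n)).
  by rewrite -(expnM 16 2) leq_exp2l //; lia.
rewrite ffact_prod -[in leqLHS](card_ord (uphalf n)) -prod_nat_const.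
apply: leq_prod => i _; have := ltn_ord i; lia.
Qed.

Unset Implicit Arguments.

Theorem theorem3 (R : realType) (c : nat) (hc : 2 < c) :
  exists d : R, (0 < d)%R /\ (d <= 1)%R /\
    forall n : nat, 1 <= n ->
      (Num.truncn (d * n%:R)%R)`! <= M n (non_multiples c).
Proof.
exists (512%:R^-1)%R; split; first by rewrite Num.Theory.invr_gt0 Num.Theory.ltr0n.
split; first by rewrite Num.Theory.invf_le1 ?Num.Theory.ler1n ?Num.Theory.ltr0n.
move=> n n_gt0; set m := Num.truncn _.
have m_le : m * 512 <= n.
  rewrite -(Num.Theory.ler_nat R) GRing.natrM.
  rewrite -Num.Theory.ler_pdivlMr ?Num.Theory.ltr0n // GRing.mulrC.
  by rewrite Num.Theory.truncn_le Num.Theory.mulr_ge0 ?Num.Theory.invr_ge0.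
have M_ge := fact_le_M n_gt0 hc.
(* For small [n] the factorial is [0! = 1], and [M] is positive by [M_ge]. *)
have [n_lt | n_ge] := ltnP n 512.
  have -> : m = 0 by lia.
  by have := fact_gt0 n; case: (M n _) M_ge => //; rewrite mul0n leqn0 => /eqP->.
have m_half : m <= n./2 by lia.
rewrite -(@leq_pmul2r (16 ^ n)) ?expn_gt0 //.
exact: leq_trans (fact_mul_exp16_le n_ge m_half) M_ge.
Qed.
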